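(* Let $G$ be an infinite abelian group of cardinality $\kappa$ such that $|\ker(x \mapsto 2x)| < \kappa$ and $|\ker(x \mapsto 3x)| < \kappa$. Let $E$ be a subset of $G$ such that for every $x \in G$, $|\{(a, b) \in E^2 \mid a+b=x\}| = \kappa$. Then there exists a Sidon set $S \subseteq E$ such that $S+S=G$.
   Context: A Sidon set in an abelian group is a subset $S$ such that for all $a,b,c,d\in S$, $a+b=c+d$ implies $\{a,b\}=\{c,d\}$. The axiom of choice is assumed. *)

(* Defs.v *)
From HB Require Import structures.
From mathcomp Require Import all_boot all_order all_algebra.
From mathcomp Require Import boolp classical_sets functions cardinality.
Set Implicit Arguments.
Unset Strict Implicit.
Unset Printing Implicit Defensive.
Import GRing.Theory.
Local Open Scope classical_set_scope.
Local Open Scope ring_scope.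
Local Open Scope card_scope.

Definition card_lt (T U : Type) (A : set T) (B : set U) : Prop :=
  A #<= B /\ A #!= B.

Definition ker_muln (G : zmodType) (n : nat) : set G := [set x | x *+ n = 0].
Arguments ker_muln : clear implicits.

(* [set a; b] and [set c; d] are unordered pairs, so a = b is allowed. *)
Definition sidon_set (G : zmodType) (S : set G) : Prop :=
  forall a b c d : G, S a -> S b -> S c -> S d ->
    a + b = c + d -> [set a; b] = [set c; d].

Definition sumset (G : zmodType) (A B : set G) : set G :=
  [set a + b | a in A & b in B].

Definition sum_reprs (G : zmodType) (E : set G) (x : G) : set (G * G) :=
  [set p | [/\ E p.1, E p.2 & p.1 + p.2 = x]].

(* Main.v *)
(** Well-order [G] so that every proper initial segment has cardinality less
    than [kappa = |G|], and run through the elements [x] of [G] in this order,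
    keeping a Sidon set [S] of cardinality less than [kappa]. If [x] is not yet
    in [S + S], add [a] and [x - a] for a suitable [a] in [E]. A choice of [a]
    fails only if [n a] belongs to a fixed set of cardinality less than [kappa]
    for some [1 <= n <= 4]; since the kernels of multiplication by 2 and 3 are
    small, so are the fibres of multiplication by [n], and fewer than [kappa]
    of the [kappa] available [a] are excluded. All cardinal estimates reduce to
    [|A * A| = |A|] for infinite [A]. *)

Require Import Defs.
From HB Require Import structures.
From mathcomp Require Import all_boot all_order all_algebra.
From mathcomp Require Import boolp classical_sets functions cardinality.
From mathcomp Require Import wochoice.
Set Implicit Arguments.
Unset Strict Implicit.
Unset Printing Implicit Defensive.
Import GRing.Theory.
Local Open Scope classical_set_scope.
Local Open Scope ring_scope.
Local Open Scope card_scope.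

(** * Cardinal arithmetic *)

(** A relation needs no value off [A] and no default point of [U], which may be empty. It need not
    be functional: choice picks an image for each point of [A]. *)
Lemma card_le_relP (T U : Type) (A : set T) (B : set U) :
  A #<= B <-> exists r : T -> U -> Prop,
    (forall x, A x -> exists2 y, B y & r x y) /\
    (forall x x' y, A x -> A x' -> r x y -> r x' y -> x = x').
Proof.
split=> [/card_leP[f]|[r [rtot rinj]]].
  exists (fun x y => exists2 a : A, val a = x & val (f a) = y); split.
    move=> x Ax; exists (val (f (SigSub (mem_set Ax)))).
      exact: set_valP.
    by exists (SigSub (mem_set Ax)).
  by move=> x x' y _ _ [a <- <-] [a' <- /val_inj /(@inj _ _ _ f)] ->//;
    exact: mem_set.
have rtotS (a : A) : exists b : B, r (val a) (val b).
  have [y By ray] := rtot _ (set_valP a).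
  by exists (SigSub (mem_set By)).
have [g rg] := choice rtotS.
have ginj : {in [set: A] &, injective g}.
  move=> a b _ _ gab; apply: val_inj.
  apply: rinj (set_valP a) (set_valP b) (rg a) _; rewrite gab; exact: rg.
by apply/card_leP; apply/injfunPex; exists g.
Qed.

Lemma card_le_fun (T U : Type) (A : set T) (B : set U) (f : T -> U) :
  (forall x, A x -> B (f x)) ->
  (forall x x', A x -> A x' -> f x = f x' -> x = x') -> A #<= B.
Proof.
move=> fAB finj; apply/card_le_relP; exists (fun x y => f x = y); split.
  by move=> x Ax; exists (f x) => //; exact: fAB.
by move=> x x' y Ax Ax' <- /esym; exact: finj.
Qed.

Lemma card_le_funE (T U : Type) (u0 : U) (A : set T) (B : set U) :
  A #<= B -> exists f : T -> U, (forall x, A x -> B (f x)) /\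
    (forall x x', A x -> A x' -> f x = f x' -> x = x').
Proof.
move=> /card_le_relP[r [rtot rinj]].
have /choice[f fP] (x : T) : exists y, A x -> B y /\ r x y.
  have [Ax|nAx] := pselect (A x); last by exists u0.
  by have [y By rxy] := rtot x Ax; exists y.
exists f; split=> [x /fP[]//|x x' Ax Ax' ff'].
apply: (rinj _ _ _ Ax Ax' (fP x Ax).2); rewrite ff'; exact: (fP x' Ax').2.
Qed.

Lemma card_leX (T T' U U' : Type) (A : set T) (A' : set T')
    (B : set U) (B' : set U') :
  A #<= A' -> B #<= B' -> A `*` B #<= A' `*` B'.
Proof.
move=> /card_le_relP[r [rt ri]] /card_le_relP[s [st si]].
apply/card_le_relP; exists (fun x y => r x.1 y.1 /\ s x.2 y.2); split.
  move=> [x y] [/= /rt[x' A'x' rx] /st[y' B'y' sy]].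
  by exists (x', y').
move=> [x y] [x' y'] [z t] [/= Ax By] [/= Ax' By'] [rxz syt] [rxz' syt'].
by rewrite (ri _ _ _ Ax Ax' rxz rxz') (si _ _ _ By By' syt syt').
Qed.

Lemma card_le_total (T U : Type) (A : set T) (B : set U) :
  A #<= B \/ B #<= A.
Proof.
pose P (F : set (T * U)) := [/\ F `<=` A `*` B,
  forall x y y', F (x, y) -> F (x, y') -> y = y' &
  forall x x' y, F (x, y) -> F (x', y) -> x = x'].
have [|F [[FAB Ffun Finj] Fmax]] := @Zorn_bigcup _ P.
  move=> C CP Ctot.
  have dir u v : (\bigcup_(X in C) X) u -> (\bigcup_(X in C) X) v ->
      exists F, [/\ C F, F u & F v].
    move=> [F CF Fu] [F' CF' F'v].
    by have [/(_ _ Fu)|/(_ _ F'v)] := Ctot _ _ CF CF'; [exists F'|exists F].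
  split=> [u [F /CP[FAB _ _] /FAB]//|x y y' h1 h2|x x' y h1 h2].
    by have [F [/CP[_ + _]]] := dir _ _ h1 h2; exact.
  by have [F [/CP[_ _ +]]] := dir _ _ h1 h2; exact.
have [Adom|/existsNP[a /not_implyP[Aa na]]] :=
    pselect (forall x, A x -> exists y, F (x, y)).
  left; apply/card_le_relP; exists (fun x y => F (x, y)); split.
    by move=> x /Adom[y Fxy]; exists y => //; have [] := FAB _ Fxy.
  by move=> x x' y _ _; exact: Finj.
have [Bran|/existsNP[b /not_implyP[Bb nb]]] :=
    pselect (forall y, B y -> exists x, F (x, y)).
  right; apply/card_le_relP; exists (fun y x => F (x, y)); split.
    by move=> y /Bran[x Fxy]; exists x => //; have [] := FAB _ Fxy.
  by move=> x x' y _ _; exact: Ffun.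
exfalso; apply: (Fmax (F `|` [set (a, b)])).
  split; first exact: subsetUl.
  by move=> /(_ (a, b)) FU; apply: na; exists b; apply: FU; right.
split=> [u [/FAB//|->//]|x y y' [Fxy|[-> ->]] [Fxy'|[]]
  |x x' y [Fxy|[-> ->]] [Fxy'|[]]].
- exact: Ffun Fxy Fxy'.
- by move=> xa; case: na; exists y; rewrite -xa.
- by case: na; exists y'.
- by move=> ->.
- exact: Finj Fxy Fxy'.
- by move=> _ yb; case: nb; exists x; rewrite -yb.
- by case: nb; exists x'.
- by move=> ->.
Qed.

Lemma card_ltNge (T U : Type) (A : set T) (B : set U) :
  card_lt A B <-> ~ (B #<= A).
Proof.
split=> [[AB /negP nAB] BA|nBA]; first by apply: nAB; exact: Cantor_Bernstein.
split; first by have [//|/nBA] := card_le_total A B.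
by apply/negP; rewrite card_eq_le => /andP[_ /nBA].
Qed.

Lemma card_le_lt_trans (T U V : Type) (A : set T) (B : set U) (K : set V) :
  A #<= B -> card_lt B K -> card_lt A K.
Proof.
move=> AB /card_ltNge nKB; apply/card_ltNge => KA.
exact: nKB (card_le_trans KA AB).
Qed.

Lemma finite_card_lt (T U : Type) (A : set T) (K : set U) :
  infinite_set K -> finite_set A -> card_lt A K.
Proof.
by move=> Kinf Afin; apply/card_ltNge => /card_le_finite/(_ Afin).
Qed.

Lemma card_leU_bool (T U : Type) (A B : set T) (C : set U) :
  A #<= C -> B #<= C -> A `|` B #<= [set: bool] `*` C.
Proof.
move=> /card_le_relP[r [rt ri]] /card_le_relP[s [st si]].
apply/card_le_relP.
exists (fun x y => if y.1 then A x /\ r x y.2 else B x /\ s x y.2); split.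
  move=> x [/[dup] Ax /rt[y Cy rxy]|/[dup] Bx /st[y Cy sxy]].
    by exists (true, y).
  by exists (false, y).
move=> x x' [[] y] _ _ /= [h1 h2] [h1' h2'].
  exact: ri h2 h2'.
exact: si h2 h2'.
Qed.

Lemma card_le_setX_infinite (T : Type) (A : set T) :
  infinite_set A -> A `*` A #<= A.
Proof.
move=> Ainf; have [t0 At0] := infinite_setN0 Ainf.
(* Zorn's lemma on graphs [F] of injections [X * X -> X], where [X] is the
   subset [D F] of [A]; the seed [F0] keeps [X] infinite. *)
pose D (F : set (T * T * T)) := [set x | exists y, F ((x, x), y)].
pose good F := [/\ forall x y z, F ((x, y), z) -> [/\ D F x, D F y & D F z],
  D F `<=` A, forall x y, D F x -> D F y -> exists z, F ((x, y), z),
  forall p z z', F (p, z) -> F (p, z') -> z = z' &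
  forall p p' z, F (p, z) -> F (p', z) -> p = p'].
have DS F F' : F `<=` F' -> D F `<=` D F'.
  by move=> FF' x [y /FF' Fy]; exists y.
have [i [iA iinj]] : exists i : nat -> T, (forall n, A (i n)) /\ injective i.
  have /infiniteP/(card_le_funE t0)[i [iA ii]] := Ainf.
  by exists i; split=> [n|m n]; [exact: iA|exact: ii].
have [c cinj] : exists c : nat * nat -> nat, injective c.
  exists pickle; exact: pcan_inj pickleK.
pose F0 : set (T * T * T) :=
  [set ((i n.1, i n.2), i (c n)) | n in [set: nat * nat]].
have DF0 n : D F0 (i n) by exists (i (c (n, n))), (n, n).
have F0good : good F0.
  split.
  - by move=> x y z [n _ [<- <- <-]].
  - by move=> x [y [n _ [<- _ _]]].
  - move=> x y [? [[m m'] _ [<- _ _]]] [? [[n n'] _ [<- _ _]]].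
    by exists (i (c (m, n))), (m, n).
  - by move=> p z z' [[m m'] _ [<- <-]] [[n n'] _ [/iinj -> /iinj -> <-]].
  - by move=> p p' z [m _ [<- <-]] [n _ [<- /iinj/cinj ->]].
(* The seed is joined inside [P] so that the empty chain, whose union is empty, also satisfies
   [P]. *)
pose P F := good (F0 `|` F).
have [|F [Fgood Fmax]] := @Zorn_bigcup _ P.
  move=> C CP Ctot; pose W := \bigcup_(X in C) X; rewrite /P -/W.
  have dir u v : (F0 `|` W) u -> (F0 `|` W) v ->
      exists F, [/\ good F, F `<=` F0 `|` W, F u & F v].
    have sub X : C X -> F0 `|` X `<=` F0 `|` W.
      by move=> CX; apply: setUS => z Xz; exists X.
    move=> [F0u|[X CX Xu]] [F0v|[Y CY Yv]].
    - by exists F0; split=> //; exact: subsetUl.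
    - by exists (F0 `|` Y); split; [exact: CP|exact: sub|left|right].
    - by exists (F0 `|` X); split; [exact: CP|exact: sub|right|left].
    have [/(_ _ Xu) Yu|/(_ _ Yv) Xv] := Ctot _ _ CX CY.
      by exists (F0 `|` Y); split; [exact: CP|exact: sub|right|right].
    by exists (F0 `|` X); split; [exact: CP|exact: sub|right|right].
  split.
  - move=> x y z h; have [F [[g _ _ _ _] FW Fh _]] := dir _ _ h h.
    by have [] := g _ _ _ Fh; split; exact: (DS _ _ FW).
  - move=> x [y h]; have [F [[_ g _ _ _] FW Fh _]] := dir _ _ h h.
    by apply: g; exists y.
  - move=> x y [x' hx] [y' hy].
    have [F [[_ _ g _ _] FW Fx Fy]] := dir _ _ hx hy.
    have [||z Fz] := g x y; [by exists x'|by exists y'|].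
    by exists z; exact: FW.
  - move=> p z z' h h'; have [F [[_ _ _ g _] _ Fh Fh']] := dir _ _ h h'.
    exact: g Fh Fh'.
  - move=> p p' z h h'; have [F [[_ _ _ _ g] _ Fh Fh']] := dir _ _ h h'.
    exact: g Fh Fh'.
move: Fgood; rewrite /P; set M := F0 `|` F => -[Mran MA Mtot Mfun Minj].
set X := D M.
have Xi n : X (i n) by apply: (DS F0 M (@subsetUl _ _ _)).
have XX : X `*` X #<= X.
  apply/card_le_relP; exists (fun p z => M (p, z)); split.
    move=> [x y] [/= Xx Xy]; have [z Mz] := Mtot _ _ Xx Xy.
    by exists z => //; have [] := Mran _ _ _ Mz.
  by move=> p p' z _ _; exact: Minj.
have boolX : [set: bool] #<= X.
  apply: (@card_le_fun _ _ _ _ (fun b : bool => i b)) => // b b' _ _ /iinj.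
  by case: b b' => [] [].
(* [X] absorbs any set that embeds in it, because two copies of [X] embed in [X * X]. *)
have leU B : B #<= X -> X `|` B #<= X.
  move=> BX; apply: card_le_trans (card_leU_bool (card_lexx X) BX) _.
  exact: card_le_trans (card_leX boolX (card_lexx X)) XX.
have [AX|/(card_le_funE t0)[f [fA finj]]] := card_le_total (A `\` X) X.
  have AleX : A #<= X.
    apply: card_le_trans (leU _ AX); apply: subset_card_le => x Ax.
    by have [|] := pselect (X x); [left|right].
  apply: card_le_trans (card_leX AleX AleX) _.
  apply: card_le_trans XX _; exact: subset_card_le.
(* [Y] is a copy of [X] in [A] disjoint from [X]. Pairs of [Z * Z] outside [X * X] are coded in [Y]
   by [f] after [h], so the codes cannot clash with those of [M], and the larger graph contradicts
   maximality. *)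
pose Y := f @` X; pose Z := X `|` Y.
have YX : Y #<= X by exact: card_image_le.
have [h [hX hinj]] : exists h : T * T -> T,
    (forall p, (Z `*` Z) p -> X (h p)) /\
    (forall p p', (Z `*` Z) p -> (Z `*` Z) p' -> h p = h p' -> p = p').
  apply: (card_le_funE t0); apply: card_le_trans XX.
  by apply: card_leX; exact: leU.
pose N : set (T * T * T) :=
  [set ((u.1, u.2), f (h u)) | u in (Z `*` Z) `\` (X `*` X)].
have NM : F0 `|` (F `|` N) = M `|` N by rewrite setUA.
have DMN : D (M `|` N) = Z.
  apply/seteqP; split=> x.
    by move=> [y [My|[[u v] [/= [Zu Zv] _] [<- _ _]]]] //; left; exists y.
  have [Xx _|nXx Zx] := pselect (X x).
    by apply: (DS M _ _ x Xx); exact: subsetUl.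
  by exists (f (h (x, x))); right; exists (x, x) => //; split=> // -[].
exfalso; apply: (Fmax (F `|` N)).
  split; first exact: subsetUl.
  (* The extension is strict: this triple cannot be in [F], as [f (i 0)] lies outside [X]. *)
  move=> /(_ ((f (i 0%N), f (i 0%N)), f (h (f (i 0%N), f (i 0%N))))) FN.
  have [_] := fA _ (Xi 0%N); apply; exists (f (h (f (i 0%N), f (i 0%N)))).
  right; apply: FN; right; exists (f (i 0%N), f (i 0%N)) => //.
  have Yi : Z (f (i 0%N)) by right; exists (i 0%N).
  by split=> // -[/= + _]; have [] := fA _ (Xi 0%N).
rewrite /P NM /good DMN; split.
- move=> x y z [/Mran[] *|[[u v] [/= [Zu Zv] _] [<- <- <-]]].
    by split; left.
  split=> //; right; exists (h (u, v)) => //; exact: hX.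
- move=> x [/MA//|[y Xy <-]]; by have [] := fA _ Xy.
- move=> x y Zx Zy; have [[Xx Xy]|nXX] := pselect ((X `*` X) (x, y)).
    by have [z Mz] := Mtot _ _ Xx Xy; exists z; left.
  by exists (f (h (x, y))); right; exists (x, y).
- move=> [x y] z z' [Mz|[[u v] [/= _ nu] [ux vy <-]]]
    [Mz'|[[u' v'] [/= _ nu'] [ux' vy' <-]]].
  + exact: Mfun Mz Mz'.
  + by case: nu'; rewrite ux' vy'; have [] := Mran _ _ _ Mz.
  + by case: nu; rewrite ux vy; have [] := Mran _ _ _ Mz'.
  + by rewrite ux vy ux' vy'.
- move=> [x y] [x' y'] z [Mz|[[u v] [/= Zu nu] [<- <- <-]]]
    [Mz'|[[u' v'] [/= Zu' nu'] [<- <-]]].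
  + exact: Minj Mz Mz'.
  + move=> fz; have [_ _] := Mran _ _ _ Mz; rewrite -fz.
    by have [] := fA _ (hX (u', v') Zu').
  + by have [_ _] := Mran _ _ _ Mz'; have [] := fA _ (hX (u, v) Zu).
  + by move=> /finj e; apply/esym/hinj => //; apply: e; exact: hX.
Qed.

Lemma card_ltX (T U V : Type) (A : set T) (B : set U) (K : set V) :
  infinite_set K -> card_lt A K -> card_lt B K -> card_lt (A `*` B) K.
Proof.
move=> Kinf.
have sq W (C : set W) : card_lt C K -> card_lt (C `*` C) K.
  move=> CK; have [Cfin|Cinf] := pselect (finite_set C).
    by apply: finite_card_lt => //; exact: finite_setX.
  by apply: card_le_lt_trans CK; exact: card_le_setX_infinite.
move=> AK BK; have [AB|BA] := card_le_total A B.
  apply: card_le_lt_trans (sq _ _ BK).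
  by apply: card_leX => //; exact: card_lexx.
apply: card_le_lt_trans (sq _ _ AK).
by apply: card_leX => //; exact: card_lexx.
Qed.

Lemma card_ltU (T V : Type) (A B : set T) (K : set V) :
  infinite_set K -> card_lt A K -> card_lt B K -> card_lt (A `|` B) K.
Proof.
move=> Kinf AK BK.
have boolK : card_lt [set: bool] K.
  by apply: finite_card_lt => //; exact: finite_finset.
have [AB|BA] := card_le_total A B.
  apply: card_le_lt_trans (card_ltX Kinf boolK BK).
  by apply: card_leU_bool => //; exact: card_lexx.
apply: card_le_lt_trans (card_ltX Kinf boolK AK).
by apply: card_leU_bool => //; exact: card_lexx.
Qed.

(** The union embeds in [D * M] by recording an index and a point of [M]. The uniform bound [M]
    avoids any regularity assumption on the cardinal of [K]. *)
Lemma card_lt_bigcup (I T U V : Type) (D : set I) (F : I -> set T)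
    (M : set U) (K : set V) :
  infinite_set K -> card_lt D K -> card_lt M K ->
  (forall i, D i -> F i #<= M) -> card_lt (\bigcup_(i in D) F i) K.
Proof.
move=> Kinf DK MK FM.
apply: card_le_lt_trans (card_ltX Kinf DK MK).
have /choice[r rP] i : exists r : T -> U -> Prop, D i ->
    (forall x, F i x -> exists2 y, M y & r x y) /\
    (forall x x' y, F i x -> F i x' -> r x y -> r x' y -> x = x').
  have [Di|] := pselect (D i); last by exists (fun _ _ => True).
  by have /card_le_relP[r rP] := FM i Di; exists r.
apply/card_le_relP.
exists (fun x p => [/\ D p.1, F p.1 x & r p.1 x p.2]); split.
  move=> x [i Di Fx]; have [y My rxy] := (rP i Di).1 x Fx.
  by exists (i, y).
move=> x x' [i y] _ _ [/= Di Fx rx] [_ Fx' rx'].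
exact: (rP i Di).2 Fx Fx' rx rx'.
Qed.

(** * Transfinite recursion *)

Lemma initial_well_order (T : choiceType) : infinite_set [set: T] ->
  exists lt : T -> T -> Prop, [/\ well_founded lt,
    forall x y z, lt x y -> lt y z -> lt x z,
    forall x y, [\/ x = y, lt x y | lt y x] &
    forall x, card_lt [set y | lt y x] [set: T]].
Proof.
move=> Tinf; have [t0 _] := infinite_setN0 Tinf.
have [R Rwo] := well_ordering_principle T.
have Rmin (A : set T) x : A x -> exists2 m, A m & forall y, A y -> R m y.
  move=> Ax; have [|m [[mA mlow] _]] := Rwo (fun z => `[< A z >]).
    by exists x; rewrite unfold_in; apply/asboolP.
  exists m; first by move: mA; rewrite unfold_in => /asboolP.
  by move=> y Ay; apply: mlow; rewrite unfold_in; apply/asboolP.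
have Rch : wo_chain R predT by move=> A _; exact: Rwo.
have Rtot x y : R x y || R y x by exact: (wo_chainW Rch).
have Ranti x y : R x y -> R y x -> x = y.
  by move=> xy yx; apply: (wo_chain_antisymmetric Rch) => //; rewrite xy yx.
pose lt x y := R x y /\ x <> y.
have ltmin (A : set T) x : A x -> exists2 m, A m & forall y, A y -> ~ lt y m.
  move=> /Rmin[m Am mlow]; exists m => // y Ay [Rym]; apply.
  by apply: Ranti Rym _; exact: mlow.
have lttot x y : [\/ x = y, lt x y | lt y x].
  have [->|/eqP xy] := eqVneq x y; first by constructor 1.
  have /orP[Rxy|Ryx] := Rtot x y; first by constructor 2.
  by constructor 3; split=> // /esym.
have lttrans x y z : lt x y -> lt y z -> lt x z.
  move=> xy yz; have [xz|//|zx] := lttot x z.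
    case: xy yz => Rxy nxy [Ryz _]; case: nxy.
    by apply: Ranti => //; rewrite xz.
  (* A cycle [x < y < z < x] would leave these three points without a minimal one. *)
  have [m] := ltmin [set x; y; z] x (or_introl (or_introl erefl)).
  by move=> [[->|->]|->] mlow;
    [case: (mlow z)|case: (mlow x)|case: (mlow y)] => //=; auto.
(* Proved for pullbacks along any [g], to serve both [lt] itself and the order transported below. *)
have ltwf (U : Type) (g : U -> T) : well_founded (fun u v => lt (g u) (g v)).
  move=> u; apply: contrapT => nu.
  have [|_ [v nv <-] vmin] := ltmin
    [set g v | v in [set v | ~ Acc (fun u v => lt (g u) (g v)) v]] (g u).
    by exists u.
  apply: nv; constructor => w wv; apply: contrapT => nw; apply: vmin wv.
  by exists w.
(* If some initial segment is not small, pull the order back along an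
   injection of [T] into the least such segment. *)
have [small|] := pselect (forall x, card_lt [set y | lt y x] [set: T]).
  by exists lt; split=> //; exact: (ltwf T id).
move=> /existsNP[x0 nx0].
have [m nm mmin] := ltmin [set x | ~ card_lt [set y | lt y x] [set: T]] _ nx0.
have /(card_le_funE t0)[g [gm ginj]] : [set: T] #<= [set y | lt y m].
  by apply: contrapT => /card_ltNge/nm.
exists (fun x y => lt (g x) (g y)); split.
- exact: ltwf.
- by move=> x y z; exact: lttrans.
- move=> x y; have [gxy|gxy|gxy] := lttot (g x) (g y).
  + by constructor 1; exact: ginj.
  + by constructor 2.
  + by constructor 3.
(* The segment of [x] embeds by [g] in that of [g x], which is small because [g x] is below the
   least bad point [m]. *)
- move=> x; apply: (@card_le_lt_trans _ _ _ _ [set y | lt y (g x)]).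
    by apply: (card_le_fun (f := g)) => // y y' _ _; exact: ginj.
  apply: contrapT => ngx; apply: (mmin (g x)) => //.
  exact: gm.
Qed.

(** Giving [step] a total function, equal to [u0] off the initial segment, keeps proofs of [lt] out
    of the recursion equation. *)
Lemma well_founded_recursion (T U : Type) (lt : T -> T -> Prop) (u0 : U)
    (step : T -> (T -> U) -> U) : well_founded lt ->
  exists F : T -> U,
    forall x, F x = step x (fun y => if pselect (lt y x) then F y else u0).
Proof.
move=> wf.
pose st x (f : forall y, lt y x -> U) :=
  step x (fun y => if pselect (lt y x) is left h then f y h else u0).
exists (Fix wf (fun=> U) st) => x; rewrite Fix_eq /st; last first.
  move=> {}x f g fg; congr step; apply/funext => y.
  by case: pselect.
by congr step; apply/funext => y; case: pselect.
Qed.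

(** * Sidon sets *)

Section Sidon.
Variable G : zmodType.
Implicit Types (S E : set G) (a b c d x : G).

(** Locating [a] suffices, since cancellation then determines [b]. *)
Lemma sidon_setP S :
  sidon_set S <-> forall a b c d, S a -> S b -> S c -> S d ->
    a + b = c + d -> a = c \/ a = d.
Proof.
split=> [sid a b c d Sa Sb Sc Sd e|sid a b c d Sa Sb Sc Sd e].
  have : [set c; d] a by rewrite -(sid a b c d) //; left.
  by move=> [->|->]; [left|right].
have [ac|ad] := sid a b c d Sa Sb Sc Sd e.
  by move: e; rewrite ac => /addrI ->.
by move: e; rewrite ad addrC => /addIr ->; rewrite setUC.
Qed.

(** The Sidon condition involves only four elements, and directedness puts them in a single
    member. *)
Lemma sidon_set_directed (D : set (set G)) :
  (forall A B, D A -> D B -> exists C, [/\ D C, A `<=` C & B `<=` C]) ->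
  (forall A, D A -> sidon_set A) -> sidon_set (\bigcup_(A in D) A).
Proof.
move=> dir sid; apply/sidon_setP => a b c d.
move=> [A DA Aa] [B DB Bb] [C DC Cc] [D' DD' Dd].
have [X [DX AX BX]] := dir _ _ DA DB.
have [Y [DY CY DY']] := dir _ _ DC DD'.
have [Z [DZ XZ YZ]] := dir _ _ DX DY.
have /sidon_setP := sid _ DZ; apply.
- exact/XZ/AX.
- exact/XZ/BX.
- exact/YZ/CY.
- exact/YZ/DY'.
Qed.

(** A nonempty fibre of multiplication by [n] is a coset of the kernel, so the kernel bounds all
    fibres uniformly. *)
Lemma card_lt_preim_muln (n : nat) (C : set G) : infinite_set [set: G] ->
  card_lt (ker_muln G n) [set: G] -> card_lt C [set: G] ->
  card_lt [set a | C (a *+ n)] [set: G].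
Proof.
move=> Ginf kern CG.
have -> : [set a | C (a *+ n)] = \bigcup_(c in C) [set a | a *+ n = c].
  by apply/seteqP; split=> a => [Ca|[c Cc /= -> //]]; exists (a *+ n).
apply: card_lt_bigcup CG kern _ => // c _.
have [[a0 a0c]|none] := pselect (exists a, a *+ n = c).
  apply: (card_le_fun (f := fun a => a - a0)) => [a /= ac|a b _ _ /addIr//].
  by rewrite /ker_muln /= mulrnBl ac a0c subrr.
apply: (card_le_fun (f := id)) => // a ac; case: none; by exists a.
Qed.

Definition pair_differences (W : set G) : set G :=
  [set p.1.1 + p.1.2 - (p.2.1 + p.2.2) | p in (W `*` W) `*` (W `*` W)].

(* Each element of [S] together with [a] and [x - a] is [n a + v] with [n] in
   {-1, 0, 1} and [v] in [S] or {0, x}. An additive coincidence whose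
   coefficients of [a] do not cancel puts a multiple of [a] in
   [pair_differences]; if they cancel, it is trivial, comes from [S], or
   expresses [x] as a sum of two elements of [S]. *)
Lemma sidon_set_pair S x a : sidon_set S -> ~ sumset S S x ->
  (forall n, (0 < n <= 4)%N ->
    ~ pair_differences (S `|` [set 0; x]) (a *+ n)) ->
  sidon_set (S `|` [set a; x - a]).
Proof.
move=> /sidon_setP sid nx na; pose W := S `|` [set 0; x].
(* [pair_differences W] is closed under negation, so excluding positive multiples of [a] also
   excludes negative ones. *)
have naz (n : int) : n <> 0 -> (`|n| <= 4)%N -> ~ pair_differences W (a *~ n).
  case: n => n n0 n4.
    by apply: na; rewrite n4 andbT lt0n; apply/eqP => e; apply: n0; rewrite e.
  move=> [[[p q] [r s]] [[Wp Wq] [Wr Ws]] /= e].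
  apply: (na n.+1) => //; exists ((r, s), (p, q)) => //=.
  by rewrite -[r + s - _]opprK opprB e NegzE mulrNz opprK.
have rep z : (S `|` [set a; x - a]) z -> exists (e : int) v,
    [/\ z = a *~ e + v, W v &
      [\/ e = 0 /\ S z, e = 1 /\ z = a | e = -1 /\ z = x - a]].
  move=> [Sz|[->|->]].
  - by exists 0, z; rewrite mulr0z add0r; split=> //; [left|constructor 1].
  - exists 1, 0; rewrite mulr1z addr0; split=> //; last by constructor 2.
    by right; left.
  - exists (-1), x; rewrite mulrN1z addrC; split=> //; last by constructor 3.
    by right; right.
apply/sidon_setP => p q r s /rep[np [vp [Ep Wp Hp]]] /rep[nq [vq [Eq Wq Hq]]]
  /rep[nr [vr [Er Wr Hr]]] /rep[ns [vs [Es Ws Hs]]] e.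
(* The bound 4 comes from four coefficients, each in {-1, 0, 1}. *)
have key : np + nq - (nr + ns) <> 0 ->
    (absz (np + nq - (nr + ns))%R <= 4)%N -> False.
  move=> n0 n4; apply: (naz _ n0 n4).
  exists ((vr, vs), (vp, vq)) => //=.
  move: e; rewrite Ep Eq Er Es mulrzBr !mulrzDr.
  rewrite addrACA [RHS]addrACA => e.
  by apply/eqP; rewrite subr_eq addrAC e addrAC subrr add0r.
have qrs : q = r \/ q = s -> p = r \/ p = s.
  move=> [qr|qs]; move: e.
    by rewrite qr addrC => /addrI; auto.
  by rewrite qs => /addIr; auto.
clear Ep Eq Er Es.
(* Of the 81 cases, those left after the automation have all four elements in [S], or have [a] and
   [x - a] on one side and two elements of [S] on the other. *)
move: Hp Hq Hr Hs => [[? Sp]|[? pE]|[? pE]] [[? Sq]|[? qE]|[? qE]]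
  [[? Sr]|[? rE]|[? rE]] [[? Ss]|[? sE]|[? sE]]; subst np nq nr ns;
  try (by case: key); try (by left; congruence); try (by right; congruence);
  try (by apply: qrs; left; congruence);
  try (by apply: qrs; right; congruence).
- exact: sid e.
all: exfalso; apply: nx.
all: try by exists r => //; exists s => //;
  rewrite -e ?pE ?qE ?subrK// addrC subrK.
all: by exists p => //; exists q => //;
  rewrite e ?rE ?sE ?subrK// addrC subrK.
Qed.

Lemma exists_sidon_pair E S x : infinite_set [set: G] ->
  card_lt (ker_muln G 2) [set: G] -> card_lt (ker_muln G 3) [set: G] ->
  sum_reprs E x #= [set: G] -> card_lt S [set: G] -> sidon_set S ->
  ~ sumset S S x ->
  exists a, [/\ E a, E (x - a) & sidon_set (S `|` [set a; x - a])].
Proof.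
move=> Ginf ker2 ker3 Ex SG sid nx.
pose W := S `|` [set 0; x]; pose C := pair_differences W.
have WG : card_lt W [set: G].
  by apply: card_ltU => //; apply: finite_card_lt => //; exact: finite_set2.
have CG : card_lt C [set: G].
  have WWG := card_ltX Ginf WG WG.
  exact: card_le_lt_trans (card_image_le _ _) (card_ltX Ginf WWG WWG).
have ker1 : card_lt (ker_muln G 1) [set: G].
  apply: finite_card_lt => //; apply: sub_finite_set (finite_set1 0).
  by move=> a; rewrite /ker_muln /= mulr1n.
(* Multiplication by 4 is doubling twice, so its kernel is the preimage under doubling of the small
   kernel of doubling. *)
have ker4 : card_lt (ker_muln G 4) [set: G].
  have -> : ker_muln G 4 = [set a | ker_muln G 2 (a *+ 2)].
    by rewrite /ker_muln; apply/seteqP; split=> a /=; rewrite -mulrnA.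
  exact: card_lt_preim_muln.
pose B n := [set a | C (a *+ n)].
have BG : card_lt (B 1%N `|` B 2 `|` B 3 `|` B 4) [set: G].
  by do ![apply: card_ltU => //]; apply: card_lt_preim_muln.
apply: contrapT => none; have /card_ltNge := BG; apply.
have := Ex; rewrite card_eq_le => /andP[_ GEx]; apply: card_le_trans GEx _.
(* A representation of [x] is determined by its first term. If every first term failed, all of them
   would lie in the small union of the [B n]. *)
apply: (card_le_fun (f := fst)) => [[a b] [/= Ea Eb abx]|]; last first.
  move=> [a b] [a' b'] [/= _ _ <-] [/= _ _ +] aa'.
  by rewrite aa' => /addrI ->.
apply: contrapT => nB; apply: none; exists a.
have xa : x - a = b by rewrite -abx addrC addKr.
split; rewrite ?xa // -xa; apply: sidon_set_pair => // n n4 Cn; apply: nB.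
by move: n n4 Cn => [|[|[|[|[|n]]]]] // _ Cn; rewrite /B /=; tauto.
Qed.

End Sidon.

(** * The transfinite construction of the Sidon set *)

Theorem theorem4p1 (G : zmodType) (E : set G)
    (Ginf : infinite_set [set: G])
    (ker2 : card_lt (ker_muln G 2) [set: G])
    (ker3 : card_lt (ker_muln G 3) [set: G])
    (hE : forall x : G, sum_reprs E x #= [set: G]) :
  exists S : set G, [/\ S `<=` E, sidon_set S & sumset S S = [set: G]].
Proof.
have [lt [ltwf lttrans lttot ltsmall]] := initial_well_order Ginf.
(* [Some a] records that stage [y] adds [a] and [y - a]; [None] records that it adds nothing. *)
pose pts (F : G -> option G) y : set G :=
  if F y is Some a then [set a; y - a] else set0.
pose cand x (U : set G) a := [/\ ~ sumset U U x, E a, E (x - a) &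
  sidon_set (U `|` [set a; x - a])].
pose step x f :=
  if pselect (exists a, cand x (\bigcup_y pts f y) a) is left h
  then Some (sval (cid h)) else None.
have [F FE] := well_founded_recursion None step ltwf.
pose below x := \bigcup_(y in [set y | lt y x]) pts F y.
pose upto x := below x `|` pts F x.
have {}FE x : (exists2 a, F x = Some a & cand x (below x) a) \/
    F x = None /\ ~ exists a, cand x (below x) a.
  (* The default [None] contributes no points, so the union over all [y] sees only earlier
     stages. *)
  have <- : \bigcup_y pts (fun y => if pselect (lt y x) then F y else None) y
      = below x.
    apply/seteqP; split=> z [y].
      by rewrite /pts; case: pselect => // yx _ Fz; exists y.
    by move=> /= yx Fz; exists y => //; rewrite /pts; case: pselect.
  rewrite FE /step; case: pselect => [h|]; last by right.
  by left; exists (sval (cid h)) => //; exact: svalP.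
(* Each stage adds at most two points, hence the uniform bound [bool]. *)
have belowG x : card_lt (below x) [set: G].
  apply: (@card_lt_bigcup _ _ bool _ _ _ [set: bool]) => //.
    by apply: finite_card_lt => //; exact: finite_finset.
  move=> y _; rewrite /pts; case: (F y) => [a|]; last exact: card_ge0.
  apply: (card_le_fun (f := fun z => z == a)) => // z z' /=.
  by move=> [->|->] [->|->] //; rewrite eqxx; [move/esym/eqP|move/eqP].
have uptoS x y : lt x y -> upto x `<=` below y.
  move=> xy z [[w wx Fz]|Fz]; last by exists x.
  by exists w => //=; exact: lttrans xy.
have dir x y : exists z,
    [/\ z = x \/ z = y, upto x `<=` upto z & upto y `<=` upto z].
  have [<-|xy|yx] := lttot x y.
  - by exists x; split; [left| |].
  - by exists y; split; [right|move=> z /(uptoS _ _ xy); left|].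
  - by exists x; split; [left| |move=> z /(uptoS _ _ yx); left].
(* An added pair preserves the Sidon property by the choice of [cand]; if nothing is added, [upto x]
   is the directed union of the earlier stages. *)
have sid x : sidon_set (upto x).
  elim/(well_founded_ind ltwf): x => x IH.
  have [[a Fx [_ _ _ +]]|[Fx _]] := FE x; first by rewrite /upto /pts Fx.
  have ptsx : pts F x = set0 by rewrite /pts Fx.
  rewrite /upto ptsx setU0.
  have -> : below x = \bigcup_(A in [set upto y | y in [set y | lt y x]]) A.
    apply/seteqP; split=> z.
      by move=> [y yx Fz]; exists (upto y); [exists y|right].
    by move=> [_ [y yx <-]]; exact: uptoS.
  apply: sidon_set_directed => [_ _ [y yx <-] [y' y'x <-]|_ [y yx <-]].
    have [z [zE yz y'z]] := dir y y'; exists (upto z); split=> //.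
    by exists z => //=; case: zE => ->.
  exact: IH.
have sidb x : sidon_set (below x).
  apply/sidon_setP => a b c d; have /sidon_setP := sid x => + ? ? ? ?.
  by apply; left.
exists (\bigcup_(A in range upto) A); split.
- have sub y : pts F y `<=` E.
    move=> z; rewrite /pts.
    by have [[a -> [_ Ea Exa _]] [->|->]|[-> _]] := FE y.
  by move=> z [_ [x _ <-]] [[y _]|]; exact: sub.
- apply: sidon_set_directed => [_ _ [x _ <-] [y _ <-]|_ [x _ <-]//].
  by have [z [_ xz yz]] := dir x y; exists (upto z); split=> //; exists z.
- apply/seteqP; split=> // x _.
  suff [a Ua [b Ub ab]] : sumset (upto x) (upto x) x.
    by exists a; [exists (upto x)|exists b => //; exists (upto x)].
  have [[a Fx _]|[_ none]] := FE x.
    exists a; first by right; rewrite /pts Fx; left.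
    by exists (x - a); [right; rewrite /pts Fx; right|rewrite addrC subrK].
  (* If a stage adds nothing, [x] is already a sum of earlier points, since otherwise
     [exists_sidon_pair] would supply a candidate. *)
  apply: contrapT => nx; apply: none.
  have nbx : ~ sumset (below x) (below x) x.
    by move=> [a Ua [b Ub ab]]; apply: nx; exists a; [left|exists b; [left|]].
  have [a [Ea Exa sida]] :=
    exists_sidon_pair Ginf ker2 ker3 (hE x) (belowG x) (sidb x) nbx.
  by exists a.
Qed.
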